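(* Let $X$ be a complex topological vector space with $2\le\dim(X)<\infty$. Then $X$ supports no diskcyclic strongly continuous semigroup of operators; that is, no strongly continuous semigroup $(T_t)_{t\ge0}$ of operators on $X$ is diskcyclic.
   Context: Topological vector spaces are Hausdorff. An operator is a continuous linear operator, and $\mathbb{D}=\{\alpha\in\mathbb{C}:|\alpha|\le 1\}$. A strongly continuous semigroup of operators ($C_0$-semigroup) on $X$ is a family $(T_t)_{t\ge0}$ of operators on $X$ with $T_0=I$, $T_{t+s}=T_tT_s$ for all $t,s\ge0$, and $\lim_{t\to s}T_tx=T_sx$ for all $x\in X$ and $s\ge0$. It is diskcyclic if there is $x\in X$ such that $\{\alpha T_tx:\alpha\in\mathbb{D},\,t\ge0\}$ is dense in $X$. *)

(* Defs.v *)
From HB Require Import structures.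
From mathcomp Require Import all_boot all_order all_algebra.
From mathcomp Require Import all_classical all_reals all_analysis.
From mathcomp Require Import complex.

Set Implicit Arguments.
Unset Strict Implicit.
Unset Printing Implicit Defensive.

Import Order.TTheory GRing.Theory Num.Theory.
Import numFieldNormedType.Exports.

Local Open Scope classical_set_scope.
Local Open Scope ring_scope.

(* Finite-dimensional topological vector spaces: no local convexity and no
   separation axiom is built in. *)
#[short(type="topologicalVectType")]
HB.structure Definition TopologicalVector (K : numFieldType) :=
  {X of Vector K X & TopologicalLmodule K X}.

Definition operator (K : numFieldType) (X : topologicalLmodType K)
    (f : X -> X) : Prop :=
  linear f /\ continuous f.

(* The semigroup is a function on all of [R], of which only the values at
   [t >= 0] matter. *)
Record C0_semigroup (R : realType) (X : topologicalLmodType R[i])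
    (T : R -> X -> X) : Prop := {
  C0_operator : forall t : R, 0 <= t -> operator (T t) ;
  C0_id : T 0 = id ;
  C0_add : forall t s : R, 0 <= t -> 0 <= s -> T (t + s) = T t \o T s ;
  C0_cvg : forall (x : X) (s : R), 0 <= s ->
    T t x @[t --> within [set t : R | 0 <= t] (nbhs s)] --> T s x
}.

Definition diskcyclic (R : realType) (X : topologicalLmodType R[i])
    (T : R -> X -> X) : Prop :=
  exists x : X,
    dense [set y | exists (a : R[i]) (t : R),
      [/\ `|a| <= 1, 0 <= t & y = a *: T t x]].

(* Main.v *)
(* On a two-dimensional quotient that all the [T t] preserve and on which they
   are triangular, the ratio of the two coordinates of [T t x] follows an affine
   flow [r |-> lam t * r + mu t] of the complex plane, and it is insensitive to
   the scalar multiplying [T t x]. A dense disk orbit would thus produce a dense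
   orbit of such a flow, but these orbits are points or lie on lines, circles or
   spirals. Transferring density to coordinates uses that linear functionals on
   a finite-dimensional Hausdorff topological vector space are continuous. *)
From HB Require Import structures.
Require Import Defs.
From mathcomp Require Import all_boot all_order all_algebra.
From mathcomp Require Import all_classical all_reals all_analysis.
From mathcomp Require Import complex ring.

Import Order.TTheory GRing.Theory Num.Theory.
Import numFieldNormedType.Exports.
Import ComplexField.Normc.
Import VectorInternalTheory.

Local Open Scope classical_set_scope.
Local Open Scope ring_scope.
Local Open Scope complex_scope.

Set Implicit Arguments.
Unset Strict Implicit.

(** * Real-valued modulus on the complex numbers *)

Lemma gt0_complexE (R : realType) (e : R[i]) : 0 < e ->
  exists2 d : R, 0 < d & e = d%:C.
Proof. by case: e => a b; rewrite ltcE/= => /andP[/eqP -> a0]; exists a. Qed.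

(** Balls in [R[i]^o] have radii in [R[i]], but a positive complex number is real, so estimates can
    be made with the real-valued [normc]. *)
Lemma cvg_normcP (R : realType) (T : Type) (F : set_system T) {FF : Filter F}
    (f : T -> R[i]^o) (l : R[i]^o) :
  f @ F --> l <-> forall e : R, 0 < e -> \forall t \near F, normc (f t - l) < e.
Proof.
split=> [/cvgrPdistC_lt fl e e0 | fl].
- have := fl e%:C; rewrite ltcR => /(_ e0); apply: filterS => t.
  by rewrite ltcR.
apply/cvgrPdistC_lt => e /gt0_complexE[d d0 ->]; apply: filterS (fl d d0) => t.
by rewrite -ltcR.
Qed.

Lemma normc_le_ReIm (R : realType) (a b : R) : normc (a +i* b) <= `|a| + `|b|.
Proof.
rewrite [a +i* b](_ : _ = a +i* 0 + 0 +i* b); last by simpc.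
by rewrite (le_trans (le_normcD _ _))//= expr0n addr0 add0r !sqrtr_sqr.
Qed.

Lemma normcB (R : realType) (z w : R[i]) : normc (z - w) = normc (w - z).
Proof. by rewrite -normcN opprB. Qed.

Lemma normc_ge0 (R : realType) (z : R[i]) : 0 <= normc z.
Proof. by case: z => a b; exact: sqrtr_ge0. Qed.

Lemma normc_eq0 (R : realType) (z : R[i]) : (normc z == 0) = (z == 0).
Proof. by apply/eqP/eqP => [/eq0_normc//|->]; rewrite normc0. Qed.

Lemma normc_gt0 (R : realType) (z : R[i]) : (0 < normc z) = (z != 0).
Proof. by rewrite lt_def normc_eq0 normc_ge0 andbT. Qed.

Lemma normcR (R : realType) (a : R) : normc a%:C = `|a|.
Proof. by rewrite /= expr0n addr0 sqrtr_sqr. Qed.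

(** * Real coordinates and continuity of linear functionals *)

Section RealCoordinates.
Variables (R : realType) (X : topologicalVectType R[i]).
Let n := \dim {:X}.
Let e : n.-tuple X := vbasis {:X}.

Let coef (v : 'rV[R]_(n + n)) (i : 'I_n) : R[i]^o :=
  v 0 (lshift n i) +i* v 0 (rshift n i).

(** Splitting coordinates into real and imaginary parts makes compactness of the unit sphere an
    instance of Heine-Borel over [R]. *)
Definition of_real_coord (v : 'rV[R]_(n + n)) : X :=
  \sum_(i < n) coef v i *: e`_i.

Lemma of_real_coordZ (a : R) v :
  of_real_coord (a *: v) = a%:C *: of_real_coord v.
Proof.
rewrite /of_real_coord scaler_sumr; apply: eq_bigr => i _; rewrite scalerA.
by congr (_ *: _); rewrite /coef !mxE; simpc.
Qed.

Lemma of_real_coord_eq0 v : of_real_coord v = 0 -> v = 0.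
Proof.
move=> v0; have /freeP fe := basis_free (vbasisP {:X}).
have c0 i : coef v i = 0 by move: i; apply: fe.
apply/rowP => i; rewrite mxE; case: (fintype.split_ordP i) => j ->.
  by case: (c0 j).
by case: (c0 j).
Qed.

Lemma of_real_coord_surj y : exists v, y = of_real_coord v.
Proof.
pose c i := coord e i y.
exists (row_mx (\row_i complex.Re (c i)) (\row_i complex.Im (c i))).
rewrite [LHS](coord_basis (vbasisP {:X}) (memvf y)).
apply: eq_bigr => i _; congr (_ *: _).
by rewrite /coef row_mxEl row_mxEr !mxE -/(c i); case: (c i).
Qed.

Lemma of_real_coord_continuous : continuous of_real_coord.
Proof.
move=> v; apply: (@cvg_big X _ _ _ _ (@add_continuous X) _ (nbhs v) _
  (fun i w => coef w i *: e`_i)) => i _.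
have cc : coef ^~ i @ v --> coef v i.
  apply/(cvg_normcP (F := nbhs v)) => d d0.
  have d20 : 0 < d / 2 by rewrite divr_gt0.
  have /cvgrPdistC_lt/(_ _ d20) h1 := @coord_continuous R _ _ 0 (lshift n i) v.
  have /cvgrPdistC_lt/(_ _ d20) h2 := @coord_continuous R _ _ 0 (rshift n i) v.
  near=> w; rewrite (le_lt_trans (normc_le_ReIm _ _))//.
  rewrite [d]splitr ltrD//.
    by near: w.
  by near: w.
apply: (continuous2_cvg _ (h := fun (a : R[i]^o) (x : X) => a *: x)
  (@scale_continuous _ X (coef v i, e`_i)) cc).
exact: cvg_cst.
Unshelve. all: by end_near. Qed.

Lemma normc_coef_le v i : normc (coef v i) <= `|v| *+ 2.
Proof.
have le_norm j : `|v 0 j| <= `|v|.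
  rewrite [leRHS]mx_normrE.
  exact: (le_bigmax _ (fun ij => `|v ij.1 ij.2|) (0, j)).
by rewrite (le_trans (normc_le_ReIm _ _))// mulr2n lerD.
Qed.

Hypothesis hX : hausdorff_space X.

(* The image of the compact unit sphere is closed and misses 0. By continuity
   of scaling, [a *: y] avoids it for small [a] and [y] near 0, whereas
   [a = 1 / |v|] sends [y = of_real_coord v] into it. *)
Lemma bounded_real_coord :
  exists M : R, \forall y \near (0 : X), forall v, y = of_real_coord v -> `|v| <= M.
Proof.
pose S : set 'rV[R]_(n + n) := [set v | `|v| = 1].
have cS : compact S.
  apply: bounded_closed_compact.
    by exists 1; split=> // x x1 v; rewrite /S/= => ->; exact: ltW.
  apply: (@preimage_closed _ _ (fun v : 'rV[R]_(n + n) => `|v|) [set 1]).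
    by move=> v _; exact: norm_continuous.
  exact: closed_eq.
have cl : closed (of_real_coord @` S).
  (* The Hausdorff hypothesis enters here: it makes the compact image closed. *)
  apply: compact_closed => //; apply: continuous_compact => //.
  exact/continuous_subspaceT/of_real_coord_continuous.
have n0 : nbhs (0 : X) (~` (of_real_coord @` S)).
  apply: open_nbhs_nbhs; split; first exact: closed_openC.
  move=> [v Sv /of_real_coord_eq0 v0]; move: Sv; rewrite /S/= v0 normr0.
  by move/esym/eqP; rewrite oner_eq0.
have := @scale_continuous _ X (0, 0); rewrite /continuous_at /= scale0r.
move=> /(_ _ n0)[[/= A B] [A0 B0] AB].
have [d d0 dA] : exists2 d : R, 0 < d & forall a, `|a| < d -> A a%:C.
  have /nbhs_ballP[_ /gt0_complexE[d d0 ->] dA] := A0.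
  exists d => // a ad; apply: dA; rewrite /ball/= sub0r normrN.
  by rewrite -normcR ltcR normcR in ad *.
exists d^-1; apply: filterS B0 => y By v yv; rewrite leNgt; apply/negP => vd.
have v0 : 0 < `|v| by rewrite (lt_trans _ vd)// invr_gt0.
have /= := AB (`|v|^-1%:C, y); apply.
  split => //=; apply: dA; rewrite ger0_norm ?invr_ge0 ?ltW//.
  by rewrite -[ltRHS]invrK ltf_pV2 ?posrE ?invr_gt0.
exists (`|v|^-1 *: v); last by rewrite of_real_coordZ yv.
by rewrite /S/= normrZ normfV normr_id mulVf// gt_eqF.
Qed.

(** Bounded coordinates near 0 make [l] bounded near 0, and linearity spreads this to continuity
    everywhere. *)
Lemma linear_functional_continuous (l : {linear X -> R[i]^o}) : continuous l.
Proof.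
have [M Mb] := bounded_real_coord.
pose N := \sum_(i < n) `|M| *+ 2 * normc (l e`_i) + 1.
have N0 : 0 < N.
  rewrite ltr_pwDr// sumr_ge0// => i _.
  by rewrite mulr_ge0 ?normc_ge0// mulrn_wge0.
have bl : \forall y \near (0 : X), normc (l y) < N.
  apply: filterS Mb => y My; have [v yv] := of_real_coord_surj y.
  rewrite yv linear_sum/= ltr_pwDr//.
  apply: (@le_trans _ _ (\sum_(i < n) normc (l (coef v i *: e`_i)))).
    elim/big_ind2 : _ => [|x1 x2 y1 y2 h1 h2|//]; first by rewrite normc0.
    by rewrite (le_trans (le_normcD _ _))// lerD.
  apply: ler_sum => i _; rewrite linearZ/= normcM ler_wpM2r ?normc_ge0//.
  rewrite (le_trans (normc_coef_le _ _))// lerMn2r/=.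
  by rewrite (le_trans (My _ yv))// ler_norm.
move=> x; apply/cvg_normcP => d d0.
(* For [y] near [x], [k *: (y - x)] is still near 0, where [l] is below [N]; dividing by [N / d]
   leaves [d]. *)
pose k : R[i] := (N / d)%:C.
have : k *: (y - x) @[y --> x] --> (0 : X).
  rewrite -[in X in _ --> X](scaler0 _ k) -[in X in _ --> X](subrr x).
  have sx : y - x @[y --> x] --> x - x.
    exact: (continuous2_cvg _ (h := fun a b : X => a - b)
      (@tvs.sub_continuous X (x, x)) cvg_id (cvg_cst _)).
  exact: (continuous2_cvg _ (h := fun (a : R[i]^o) (x : X) => a *: x)
    (@scale_continuous _ X (k : R[i]^o, x - x)) (cvg_cst _) sx).
move=> /(_ _ bl); apply: (@filterS _ (nbhs x)) => y /=.
rewrite linearZ linearB normcM normcR ger0_norm ?divr_ge0 ?ltW//.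
by rewrite mulrAC -mulrA gtr_pMr// ltr_pdivrMr// mul1r.
Qed.

End RealCoordinates.

(** * Common eigenvectors modulo an invariant subspace *)

Section RelativeEigenvectors.
Variables (F : closedFieldType).

(* Applying the linear factors of the characteristic polynomial one after the
   other, the last vector before falling into [Q] is the one sought. *)
Lemma eigenvector_mod n m k (A : 'M[F]_n) (Q : 'M[F]_(m, n)) (W : 'M[F]_(k, n)) :
  stablemx W A -> ~~ (W <= Q)%MS ->
  exists a (w : 'rV[F]_n), [/\ (w <= W)%MS, ~~ (w <= Q)%MS &
    (w *m (A - a%:M) <= Q)%MS].
Proof.
move=> WA /row_subPn[i WiQ].
case: n => [|n] in A Q W WA WiQ *; first by rewrite thinmx0 sub0mx in WiQ.
have [r Ar] := closed_field_poly_normal (char_poly A).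
have {}Ar : \prod_(z <- r) (A - z%:M) = 0.
  have := Cayley_Hamilton A.
  rewrite Ar (monicP (char_poly_monic A)) scale1r rmorph_prod /= => <-.
  by apply: eq_bigr => z _; rewrite rmorphB /= horner_mx_X horner_mx_C.
have : (row i W *m \prod_(z <- r) (A - z%:M) <= Q)%MS by rewrite Ar mulmx0 sub0mx.
have := row_sub i W; elim: r (row i W) WiQ {Ar} => [|z r IHr] w wQ wW.
  by rewrite big_nil mulmx1 (negPf wQ).
rewrite big_cons => wr; have [wzQ|wzQ] := boolP (w *m (A - z%:M) <= Q)%MS.
  by exists z, w.
apply: IHr wzQ _ _; last by rewrite -mulmxA.
rewrite mulmxBr addmx_sub ?(submx_trans (submxMr _ wW))// mul_mx_scalar.
by rewrite -scaleNr scalemx_sub.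
Qed.

(* A smallest stable space strictly above [Q] consists of such vectors, since
   the relative eigenspaces of each [A i] in it are again stable. *)
Lemma common_eigenvector_mod (I : Type) n m (A : I -> 'M[F]_n) (Q : 'M[F]_(m, n)) :
  (forall i j, comm_mx (A i) (A j)) -> (forall i, stablemx Q (A i)) ->
  (\rank Q < n)%N ->
  exists2 p : 'rV[F]_n, ~~ (p <= Q)%MS &
    forall i, exists a, (p *m A i - a *: p <= Q)%MS.
Proof.
move=> Acomm QA rQ.
pose P (k : nat) := `[< exists W : 'M[F]_n, [/\ forall i, stablemx W (A i),
  (Q <= W)%MS, ~~ (W <= Q)%MS & \rank W = k] >].
have exP : exists k, P k.
  exists n; apply/asboolP; exists 1%:M; split; rewrite ?mxrank1 ?submx1//.
    by move=> i; exact: submx1.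
  by rewrite sub1mx /row_full neq_ltn rQ.
case: (ex_minnP exP) => k /asboolP[W [WA QW WQ rW]] kmin.
have [i0 WiQ] := row_subPn WQ.
exists (row i0 W) => // i.
have [a [w [wW wQ waQ]]] := eigenvector_mod (WA i) WQ.
(* The relative eigenspace for [a]; multiplying by [cokermx Q] tests membership in [Q]. *)
exists a; pose U := (W :&: kermx ((A i - a%:M) *m cokermx Q))%MS.
have subU l (B : 'M[F]_(l, n)) :
    (B <= U)%MS = (B <= W)%MS && (B *m (A i - a%:M) <= Q)%MS.
  by rewrite sub_capmx sub_kermx mulmxA -submxE.
have WU : (W <= U)%MS.
  have UW : (U <= W)%MS by rewrite capmxSl.
  rewrite -(mxrank_leqif_sup UW).2 eqn_leq mxrankS//= rW.
  (* By minimality of the rank, [U] fills [W] once it is stable and strictly above [Q]. *)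
  apply: kmin; apply/asboolP; exists U; split=> //.
  - move=> j; rewrite subU; apply/andP; split.
      by rewrite (submx_trans (submxMr _ UW)) ?WA.
    have := submx_refl U; rewrite subU => /andP[_ UQ].
    have AjC : A j *m (A i - a%:M) = (A i - a%:M) *m A j.
      by rewrite mulmxBr mulmxBl Acomm scalar_mxC.
    by rewrite -mulmxA AjC mulmxA (submx_trans (submxMr _ UQ)) ?QA.
  - rewrite subU QW mulmxBr addmx_sub ?QA// mul_mx_scalar -scaleNr.
    by rewrite scalemx_sub.
  - apply: contra wQ; apply: submx_trans; by rewrite subU wW.
have := submx_trans (row_sub i0 W) WU.
by rewrite subU mulmxBr mul_mx_scalar => /andP[].
Qed.

End RelativeEigenvectors.

(** * Continuity of the modulus and of the real part *)

Lemma near_normc (R : realType) (z : R[i]^o) (e : R) :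
  0 < e -> \forall w \near z, normc (w - z) < e.
Proof.
move=> e0; apply/nbhs_ballP; exists e%:C; first by rewrite /= ltcR.
by move=> w; rewrite /ball/= normcB ltcR.
Qed.

Lemma ler_dist_normc (R : realType) (z w : R[i]) :
  `|normc z - normc w| <= normc (z - w).
Proof. exact: (@ler_dist_dist R (Rcomplex R) z w). Qed.

Lemma normc_continuous (R : realType) : continuous (@normc R : R[i]^o -> R).
Proof.
move=> z; apply/(cvgrPdistC_lt (F := nbhs z)) => e e0.
near=> w; apply: le_lt_trans (ler_dist_normc _ _) _.
by near: w; exact: near_normc.
Unshelve. all: by end_near. Qed.

Lemma Re_normc_le (R : realType) (z : R[i]) : `|complex.Re z| <= normc z.
Proof. by rewrite -lecR; exact: normc_ge_Re. Qed.

Lemma Re_continuous (R : realType) : continuous (@complex.Re R : R[i]^o -> R).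
Proof.
move=> z; apply/(cvgrPdistC_lt (F := nbhs z)) => e e0.
near=> w; apply: le_lt_trans (_ : normc (w - z) < e).
  by rewrite (le_trans _ (Re_normc_le _))//; case: (w) (z) => ? ? [].
by near: w; exact: near_normc.
Unshelve. all: by end_near. Qed.

(** * Additive and multiplicative functions of a nonnegative time *)

Definition continuous_ge0 (R : realType) (U : topologicalType) (f : R -> U) :=
  forall s : R, 0 <= s ->
  f t @[t --> within [set t : R | 0 <= t] (nbhs s)] --> f s.

Lemma continuous_ge0_comp (R : realType) (U V : topologicalType)
    (f : R -> U) (g : U -> V) :
  continuous_ge0 f -> (forall s, 0 <= s -> {for f s, continuous g}) ->
  continuous_ge0 (g \o f).
Proof. by move=> cf cg s s0; apply: cvg_comp (cf s s0) (cg s s0). Qed.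

(* [g t = f t - t * f 1] is additive and 1-periodic, hence bounded, hence 0. *)
Lemma additive_ge0E (R : realType) (f : R -> R) :
  (forall t s, 0 <= t -> 0 <= s -> f (t + s) = f t + f s) ->
  continuous_ge0 f -> forall t, 0 <= t -> f t = t * f 1.
Proof.
move=> fD cf; pose g t := f t - t * f 1.
have gD t s : 0 <= t -> 0 <= s -> g (t + s) = g t + g s.
  by move=> t0 s0; rewrite /g fD// mulrDl opprD addrACA.
have g1 : g 1 = 0 by rewrite /g mul1r subrr.
have [M M0 gM01] : exists2 M, 0 <= M & forall t, 0 <= t <= 1 -> `|g t| <= M.
  have cf01 : {within `[0, 1], continuous f}.
    apply/subspace_continuousP => s /=; rewrite in_itv/= => /andP[s0 _].
    move=> A /(cf s s0); rewrite !nbhs_simpl /within/=.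
    apply: (@filterS _ (nbhs s)) => t At.
    by rewrite in_itv/= => /andP[t0 _]; exact: At.
  have /compact_bounded[N [_ Nf]] :=
    continuous_compact cf01 (@segment_compact _ 0 1).
  have fN t : 0 <= t <= 1 -> `|f t| <= `|N| + 1.
    move=> t01; apply: Nf; first by rewrite ltr_pwDr// ler_norm.
    by exists t => //=; rewrite in_itv.
  exists ((`|N| + 1) *+ 2); first by rewrite mulrn_wge0// addr_ge0.
  move=> t t01; rewrite (le_trans (ler_normB _ _))// mulr2n lerD ?fN//.
  have /andP[t0 t1] := t01.
  by rewrite normrM ger0_norm// (le_trans (ler_piMl _ t1))// fN// ler01 lexx.
have gM t : 0 <= t -> `|g t| <= M.
  have [n tn] : exists n : nat, t <= n%:R + 1.
    exists (Num.truncn `|t|).+1; rewrite (le_trans (ler_norm _))// ltW//.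
    by rewrite (lt_le_trans (truncnS_gt _))// ler_wpDr.
  elim: n t tn => [|n IHn] t tn t0; first by rewrite gM01// t0 -[1]add0r.
  have [t1|t1] := leP t 1; first by rewrite gM01// t0 t1.
  rewrite -[t](subrK 1) gD ?subr_ge0 ?(ltW t1)// g1 addr0 IHn ?subr_ge0 ?(ltW t1)//.
  by rewrite lerBlDr -natr1 in tn *.
have gMn n t : 0 <= t -> g (n%:R * t) = n%:R * g t.
  move=> t0; elim: n => [|n IHn].
    have := gD 0 0 (lexx _) (lexx _); rewrite addr0 !mul0r => /esym/eqP.
    by rewrite -subr_eq0 addrK => /eqP.
  by rewrite -natr1 !mulrDl !mul1r gD ?mulr_ge0// IHn.
move=> t t0; apply/eqP; rewrite -subr_eq0 -/(g t) -normr_le0 leNgt.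
(* The multiple exceeds [M / |g t|], so [g] would break its bound there. *)
apply/negP => gt0; have := gM ((Num.truncn (M / `|g t|)).+1%:R * t).
rewrite mulr_ge0// => /(_ isT); apply/negP; rewrite -ltNge gMn// normrM normr_nat.
by rewrite -ltr_pdivrMr// truncnS_gt.
Qed.

(** Near 0, [c] is close to 1 and cannot vanish; [c t] is a power of [c (t / n)] with [t / n] that
    small. *)
Lemma multiplicative_ge0_neq0 (R : realType) (c : R -> R[i]^o) :
  (forall t s, 0 <= t -> 0 <= s -> c (t + s) = c t * c s) ->
  c 0 = 1 -> continuous_ge0 c -> forall t, 0 <= t -> c t != 0.
Proof.
move=> cD c0 cc t t0.
have /cvg_normcP/(_ _ ltr01) := cc 0 (lexx _).
rewrite /within/= => /nbhs_ballP[d /= d0 cd].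
pose n := (Num.truncn (t / d)).+1.
have n0 : 0 < n%:R :> R by rewrite ltr0n.
pose s := t / n%:R; have s0 : 0 <= s by rewrite divr_ge0// ltW.
have cs : c s != 0.
  have : normc (c s - c 0) < 1.
    apply: cd => //; rewrite /ball/= sub0r normrN ger0_norm//.
    by rewrite ltr_pdivrMr// mulrC -ltr_pdivrMr// truncnS_gt.
  apply: contraTneq => ->; rewrite c0 sub0r normcN normc1.
  by rewrite ltxx.
have cM k : c (k%:R * s) = c s ^+ k.
  elim: k => [|k IHk]; first by rewrite mul0r c0.
  by rewrite -natr1 mulrDl mul1r cD ?mulr_ge0// IHk exprSr.
by rewrite -[t](divfK (lt0r_neq0 n0)) mulrC cM expf_neq0.
Qed.

(** * Orbits of affine flows of the complex plane *)

Section AffineOrbit.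
Variables (R : realType) (lam mu : R -> R[i]^o).
Hypotheses (lamD : forall t s, 0 <= t -> 0 <= s -> lam (t + s) = lam t * lam s)
  (lam_neq0 : forall t, 0 <= t -> lam t != 0) (lam_cont : continuous_ge0 lam)
  (muD : forall t s, 0 <= t -> 0 <= s -> mu (t + s) = lam t * mu s + mu t)
  (mu_cont : continuous_ge0 mu).

(* A spiral (or circle): its modulus is [expR (t * L)], so near [- lam 1] only
   times near 1 could occur if [L != 0]. *)
Lemma multiplicative_orbit_not_dense :
  exists z, exists2 e : R, 0 < e & forall t, 0 <= t -> e <= normc (lam t - z).
Proof.
pose f t := ln (normc (lam t)).
have n0 t : 0 <= t -> 0 < normc (lam t) by move=> t0; rewrite normc_gt0 lam_neq0.
have fE t : 0 <= t -> f t = t * f 1.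
  move: t; apply: additive_ge0E => [t s t0 s0|].
    by rewrite /f lamD// normcM lnM// posrE n0.
  suff : continuous_ge0 ((@ln R \o @normc R : R[i]^o -> R) \o lam) by exact.
  apply: continuous_ge0_comp => [|s s0]; first exact: lam_cont.
  apply: continuous_comp; first exact: normc_continuous.
  exact/continuous_ln/n0.
have [f10|f10] := eqVneq (f 1) 0.
  exists 0, 1 => // t t0; rewrite subr0 -ler_ln ?posrE ?n0// ln1.
  by rewrite -/(f t) fE// f10 mulr0.
have /cvg_normcP/(_ _ (n0 1 ler01)) := lam_cont ler01.
rewrite /within/= => /nbhs_ballP[d /= d0 lamd].
have df0 : 0 < d * `|f 1| by rewrite mulr_gt0// normr_gt0.
have /cvgrPdist_lt/(_ _ df0) := continuous_ln (n0 1 ler01).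
move=> /nbhs_ballP[e /= e0 lne].
(* A modulus within [e] of that of [lam 1] forces [t] within [d] of 1, so [lam t] is too close to
   [lam 1] to be close to its antipode as well. *)
exists (- lam 1), (Num.min e (normc (lam 1))); first by rewrite lt_min e0 n0 ?ler01.
move=> t t0; rewrite opprK leNgt lt_min; apply/negP => /andP[lte ltn].
have : ball (normc (lam 1)) e (normc (lam t)).
  rewrite /ball/= distrC (le_lt_trans _ lte)//.
  by rewrite -[normc (lam 1)]normcN -{2}[lam 1]opprK ler_dist_normc.
move=> /lne; rewrite -/(f t) -/(f 1) (fE t t0) -{1}[f 1]mul1r -mulrBl normrM.
rewrite ltr_pM2r ?normr_gt0// => /lamd => /(_ t0) lt1.
have : normc (lam 1 + lam 1) < normc (lam 1) + normc (lam 1).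
  rewrite [lam 1 + lam 1](_ : _ = (lam t + lam 1) + - (lam t - lam 1)).
    by rewrite (le_lt_trans (le_normcD _ _))// normcN ltrD.
  by rewrite opprB [lam t + _]addrC addrACA subrr addr0.
by rewrite -mulr2n normcMn mulr2n ltxx.
Qed.

(** Here [mu] is additive; a factor [k] making [k * mu 1] imaginary makes every [k * mu t]
    imaginary, so the orbit lies on a line. *)
Lemma additive_orbit_not_dense (r0 : R[i]) : (forall t, 0 <= t -> lam t = 1) ->
  exists z, exists2 e : R, 0 < e & forall t, 0 <= t -> e <= normc (r0 + mu t - z).
Proof.
move=> lam1.
have [k k0 k1] : exists2 k : R[i]^o, k != 0 & complex.Re (k * mu 1) = 0.
  have [->|m0] := eqVneq (mu 1) 0; first by exists 1; rewrite ?oner_neq0// mulr0.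
  exists ('i * (mu 1)^-1); last by rewrite divfK.
  by rewrite mulf_neq0 ?invr_eq0// eq_complex /= oner_eq0 andbF.
have fE t : 0 <= t -> complex.Re (k * mu t) = 0.
  move=> t0; rewrite -(mulr0 t) -[X in _ = _ * X]k1.
  apply: (@additive_ge0E R (fun t => complex.Re (k * mu t))) t t0 => [t s t0 s0|].
    by rewrite muD// lam1// mul1r mulrDr addrC; case: (k * _) (k * _) => ? ? [].
  suff : continuous_ge0 ((@complex.Re R \o *%R k : R[i]^o -> R) \o mu) by exact.
  apply: continuous_ge0_comp => [|s s0]; first exact: mu_cont.
  apply: continuous_comp; last exact: Re_continuous.
  exact: (@mulrl_continuous R[i] k).
(* A point off that line: [k] times its difference with an orbit point has real part of modulus
   1. *)
exists (r0 + k^-1), (normc k)^-1; first by rewrite invr_gt0 normc_gt0.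
move=> t t0; rewrite -(ler_pM2l (x := normc k)) ?normc_gt0// -normcM.
rewrite divff ?normc_eq0// opprD addrACA subrr add0r mulrBr divff//.
apply: le_trans (Re_normc_le _).
have -> : complex.Re (k * mu t - 1) = complex.Re (k * mu t) - 1.
  by case: (k * _) => ? ?.
by rewrite fE// sub0r normrN normr1.
Qed.

(* Unless [lam] is 1, the affine maps [z |-> lam t * z + mu t] have a common
   fixed point, about which they act linearly. *)
Lemma affine_orbit_not_dense (r0 : R[i]) :
  exists z, exists2 e : R, 0 < e & forall t, 0 <= t ->
    e <= normc (lam t * r0 + mu t - z).
Proof.
have [lam1|/existsNP[s /not_implyP[s0 /eqP ls]]] :=
    pselect (forall t, 0 <= t -> lam t = 1).
  have [z [e e0 ze]] := additive_orbit_not_dense r0 lam1.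
  by exists z, e => // t t0; rewrite lam1// mul1r ze.
(* [- k] is the fixed point of the map at time [s]. *)
pose k := mu s / (lam s - 1).
have ls1 : lam s - 1 != 0 by rewrite subr_eq0.
have kE : (lam s - 1) * k = mu s by rewrite /k mulrC divfK.
(* Expanding [mu (s + t)] in both orders shows that [- k] is fixed at all times. *)
have muE t : 0 <= t -> mu t = (lam t - 1) * k.
  move=> t0; have := muD s0 t0; rewrite addrC muD// => H.
  apply: (mulfI ls1); rewrite mulrCA kE !mulrBl.
  by apply/eqP; rewrite !mul1r subr_eq addrAC eq_sym subr_eq H.
have orbE t : 0 <= t -> lam t * r0 + mu t = lam t * (r0 + k) - k.
  by move=> t0; rewrite muE// mulrBl mul1r addrA -mulrDr.
have [w0|w0] := eqVneq (r0 + k) 0.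
  exists (1 - k), 1 => // t t0; rewrite orbE// w0 mulr0 sub0r.
  by rewrite opprB addrA addNr sub0r normcN normc1.
have [z [e e0 ze]] := multiplicative_orbit_not_dense.
(* The disk missed by [lam], carried over by [w |-> w * (r0 + k) - k]. *)
exists (z * (r0 + k) - k), (e * normc (r0 + k)).
  by rewrite mulr_gt0// normc_gt0.
move=> t t0; rewrite orbE// opprB addrA subrK -mulrBl normcM.
by rewrite ler_wpM2r ?normc_ge0// ze.
Qed.

End AffineOrbit.

(** * Simultaneous triangularization in the dual space *)

(* Two independent functionals spanning a chain of invariant subspaces of the
   dual; equivalently, a triangular action on a two-dimensional quotient. *)
Lemma commuting_triangular_functionals (F : closedFieldType) (X : vectType F)
    (I : Type) (T : I -> {linear X -> X}) :
  (forall i j x, T i (T j x) = T j (T i x)) -> (2 <= \dim {:X})%N ->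
  exists l1 l2 : {linear X -> F^o}, [/\
    forall i, exists c, forall x, l1 (T i x) = c * l1 x,
    forall i, exists a b, forall x, l2 (T i x) = a * l2 x + b * l1 x &
    forall z1 z2, exists x, l1 x = z1 /\ l2 x = z2].
Proof.
rewrite dimvf => TC dimX; set n := dim X in dimX.
(* Row vectors [p] stand for functionals; composing with [T i] is then right multiplication by
   [(A i)^T]. *)
pose fct (p : 'rV[F]_n) (x : X) : F^o := (v2r x *m p^T) 0 0.
have fct_linear p : linear (fct p).
  by move=> a x y; rewrite /fct linearP mulmxDl -scalemxAl !mxE.
pose lfct p : {linear X -> F^o} :=
  HB.pack (fct p) (GRing.isLinear.Build F X F^o *:%R (fct p) (fct_linear p)).
have lfctE p x : lfct p x = (v2r x *m p^T) 0 0 by [].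
pose A i : 'M[F]_n := lin1_mx (v2r \o T i \o r2v).
have AE i (x : X) : v2r x *m A i = v2r (T i x) by rewrite mul_rV_lin1 /= v2rK.
have lfctT p i x : lfct p (T i x) = lfct (p *m (A i)^T) x.
  by rewrite !lfctE trmx_mul trmxK mulmxA AE.
have AC i j : comm_mx (A i)^T (A j)^T.
  rewrite /comm_mx -!trmx_mul; congr trmx; apply/row_matrixP => k.
  by rewrite !rowE -[delta_mx _ _](@r2vK F X) !mulmxA !AE TC.
have [q q0 qA] : exists2 q : 'rV[F]_n, q != 0 &
    forall i, exists a, q *m (A i)^T = a *: q.
  have [|i||q q0 qA] := @common_eigenvector_mod F I n n (fun i => (A i)^T) 0.
  - exact: AC.
  - by rewrite mul0mx sub0mx.
  - by rewrite mxrank0 ltnW.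
  exists q => [|i]; first by rewrite -submx0.
  have [a] := qA i.
  by rewrite submx0 subr_eq0 => /eqP; exists a.
have [p pq pA] : exists2 p : 'rV[F]_n, ~~ (p <= q)%MS &
    forall i, exists a b, p *m (A i)^T = a *: p + b *: q.
  (* Second use, modulo the line of [q], which is proper since the dimension is at least 2. *)
  have [|i||p pq pA] := @common_eigenvector_mod F I n 1 (fun i => (A i)^T) q.
  - exact: AC.
  - by have [a ->] := qA i; rewrite scalemx_sub.
  - by rewrite rank_rV q0.
  exists p => // i; have [a /sub_rVP[b pab]] := pA i; exists a, b.
  by rewrite -pab addrC subrK.
exists (lfct q), (lfct p); split=> [i|i|z1 z2].
- have [a qa] := qA i; exists a => x.
  by rewrite lfctT qa !lfctE linearZ -scalemxAr mxE.
- have [a [b pab]] := pA i; exists a, b => x.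
  by rewrite lfctT pab !lfctE linearD !linearZ mulmxDr -!scalemxAr !mxE.
have : row_free (col_mx q p).
  rewrite /row_free eqn_leq rank_leq_row /= -addsmxE.
  have : (q < q + p)%MS by rewrite ltmxE addsmxSl addsmx_sub submx_refl.
  by move=> /rank_ltmx; rewrite rank_rV q0.
move=> /row_freeP[C BC].
(* A right inverse of the independent rows [q], [p] solves for prescribed values. *)
pose u : 'rV[F]_n := row_mx z1%:M z2%:M *m C^T.
have : u *m (col_mx q p)^T = row_mx z1%:M z2%:M.
  by rewrite -mulmxA -trmx_mul BC trmx1 mulmx1.
rewrite tr_col_mx mul_mx_row => /eq_row_mx[uq up].
by exists (@r2v F X u); rewrite !lfctE !r2vK uq up !mxE eqxx mulr1n.
Qed.

(** * Disk orbits of the semigroup *)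

Unset Implicit Arguments.

Theorem theorem4p3 (R : realType) (X : topologicalVectType R[i])
    (hX : hausdorff_space X) (dimX : (2 <= \dim {:X})%N)
    (T : R -> X -> X) (hT : C0_semigroup T) :
  ~ diskcyclic T.
Proof.
have [Top T0 TD Tcvg] := hT.
(* Truncating time at 0 gives a family of linear maps indexed by all of [R]. *)
have max0 (t : R) : 0 <= Num.max t 0 by rewrite le_max lexx orbT.
have Tlin t : linear (T (Num.max t 0)) by have [] := Top _ (max0 t).
pose S t : {linear X -> X} :=
  HB.pack (T (Num.max t 0)) (GRing.isLinear.Build _ X X *:%R _ (Tlin t)).
have SE t : 0 <= t -> S t = T t :> (X -> X).
  by move=> t0; rewrite /S /=; congr T; apply/max_idPl.
have SC t s x : S t (S s x) = S s (S t x).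
  rewrite -[LHS]/((T (Num.max t 0) \o T (Num.max s 0)) x).
  by rewrite -TD// addrC TD.
have [l1 [l2 [l1T l2T l12]]] := commuting_triangular_functionals SC dimX.
(* Lifts of the basis dual to [l1], [l2]; [c], [a] and [b] are the diagonal and off-diagonal entries
   of [T t] in it. *)
have [e1 [e11 e12]] := l12 1 0.
have [e2 [e21 e22]] := l12 0 1.
pose c t : R[i]^o := l1 (T t e1).
pose a t : R[i]^o := l2 (T t e2).
pose b t : R[i]^o := l2 (T t e1).
have cE t x : 0 <= t -> l1 (T t x) = c t * l1 x.
  move=> t0; have [k lk] := l1T t; rewrite -SE// lk /c -SE// lk e11.
  by rewrite mulr1.
have abE t x : 0 <= t -> l2 (T t x) = a t * l2 x + b t * l1 x.
  move=> t0; have [k [m lkm]] := l2T t; rewrite -SE// lkm /a /b -SE// !lkm.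
  by rewrite e11 e12 e21 e22 !(mulr0, mulr1, addr0, add0r).
have lT_cont (l : {linear X -> R[i]^o}) x : continuous_ge0 (fun t => l (T t x)).
  move=> s s0; apply: (cvg_comp _ _ (Tcvg x s s0)).
  exact: linear_functional_continuous.
have TDE t s x : 0 <= t -> 0 <= s -> T (t + s) x = T t (T s x).
  by move=> t0 s0; rewrite TD.
have cD t s : 0 <= t -> 0 <= s -> c (t + s) = c t * c s.
  by move=> t0 s0; rewrite {1}/c TDE// cE.
have l1e2 s : 0 <= s -> l1 (T s e2) = 0 by move=> s0; rewrite cE// e21 mulr0.
have aD t s : 0 <= t -> 0 <= s -> a (t + s) = a t * a s.
  by move=> t0 s0; rewrite {1}/a TDE// abE// l1e2// mulr0 addr0.
have bD t s : 0 <= t -> 0 <= s -> b (t + s) = a t * b s + b t * c s.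
  by move=> t0 s0; rewrite {1}/b TDE// abE.
have c_neq0 t : 0 <= t -> c t != 0.
  move: t; apply: multiplicative_ge0_neq0 => //; last exact: lT_cont.
  by rewrite /c T0.
have a_neq0 t : 0 <= t -> a t != 0.
  move: t; apply: multiplicative_ge0_neq0 => //; last exact: lT_cont.
  by rewrite /a T0.
move=> [x xdense].
pose lam t : R[i]^o := a t / c t; pose mu t : R[i]^o := b t / c t.
have divc_cont (f : R -> R[i]^o) : continuous_ge0 f ->
    continuous_ge0 (fun t => f t / c t : R[i]^o).
  move=> cf s s0; apply: cvgM; first exact: cf.
  by apply: cvgV; [exact: c_neq0|exact: lT_cont].
(* If [l1 x] were 0, this quotient would be the default 0; that case is excluded below. *)
have [|||||z [e e0 orb]] := @affine_orbit_not_dense R lam mu _ _ _ _ _ (l2 x / l1 x).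
- by move=> t s t0 s0; rewrite /lam aD// cD// invfM mulrACA.
- by move=> t t0; rewrite mulf_neq0 ?invr_eq0 ?a_neq0 ?c_neq0.
- by apply: divc_cont; exact: lT_cont.
- move=> t s t0 s0; rewrite /mu /lam bD// cD// invfM mulrDl; congr (_ + _).
    by rewrite mulrACA.
  by rewrite mulrACA divff ?mulr1 ?c_neq0.
- by apply: divc_cont; exact: lT_cont.
(* Positivity of [h y] says that [l1 y != 0] and that [l2 y / l1 y] is within [e] of [z]; clearing
   the denominator keeps [h] continuous everywhere. *)
pose h y : R := e * normc (l1 y) - normc (l2 y - z * l1 y).
have h_cont : continuous h.
  have l1c := @linear_functional_continuous R X hX l1.
  have l2c := @linear_functional_continuous R X hX l2.
  move=> y; apply: cvgB.
    apply: cvgM; first exact: cvg_cst.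
    exact: (cvg_comp _ _ (l1c y) (@normc_continuous R _)).
  apply: (@cvg_comp _ _ _ (fun y => l2 y - z * l1 y : R[i]^o) (@normc R)
    _ _ _ _ (@normc_continuous R _)).
  apply: cvgB; first exact: l2c.
  by apply: cvgM; [exact: cvg_cst|exact: l1c].
have [||y [hy [al [t [_ t0 yE]]]]] := xdense (h @^-1` [set r | 0 < r]).
- have [y [l1y l2y]] := l12 1 z; exists y.
  by rewrite /h /= l1y l2y mulr1 subrr normc0 subr0 normc1 mulr1.
- apply: open_comp => [y _|]; [exact: h_cont|exact: open_gt].
pose g : R[i] := al * (c t * l1 x).
have l1y : l1 y = g by rewrite yE linearZ /= cE.
have l2y : l2 y = al * (a t * l2 x + b t * l1 x) by rewrite yE linearZ /= abE.
move: hy; rewrite /h /= subr_gt0 l1y l2y => hy.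
have g0 : g != 0.
  apply: contraTneq hy => ->; rewrite normc0 [e * 0]mulr0 -leNgt; exact: normc_ge0.
have l1x : l1 x != 0 by apply: contraNneq g0 => l1x; rewrite /g l1x !mulr0.
(* Factoring out [g = l1 y] leaves an affine orbit point within [e] of [z]. *)
move: hy; rewrite [X in normc X](_ : _ = g * (lam t * (l2 x / l1 x) + mu t - z)).
  rewrite normcM [e * _]mulrC ltr_pM2l ?normc_gt0// ltNge => /negP; apply.
  exact: orb.
rewrite /g /lam /mu; field.
by rewrite l1x c_neq0.
Qed.
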